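(* Let $L_0(\lambda)=\sum_{k=-m}^{1}L_0^{(k)}\lambda^k$ ($m\in\mathbb{N}$, $L_0^{(k)}\in\mathbb{C}^{n\times n}$, $\lambda\in S^1$), let $t\in\mathbb{C}$, $G=\exp(tL_0)$, and let $T_G=P^+GI_+\colon[C_\mu^+]^n\to[C_\mu^+]^n$, $\Phi\mapsto P^+(G\Phi)$. Then $\ker T_G$ is nontrivial if and only if the Riemann-Hilbert problem $$G\Phi^+=\Phi^-\ \text{ on } S^1,\qquad \Phi^\pm\in[C_\mu^\pm]^n,\qquad \Phi^-(\infty)=0,$$ has nontrivial solutions $(\Phi^+,\Phi^-)$.
   Context: $S^1$ is the unit circle, $\mathbb{D}$ the open unit disc. $C_\mu(S^1)$ is the space of complex-valued Hölder continuous functions on $S^1$ with fixed exponent $\mu\in(0,1)$. There is a direct sum decomposition $[C_\mu(S^1)]^n=[C_\mu^+]^n\oplus[C_\mu^-]^n_0$, where $[C_\mu^+]^n$ is the subspace of functions having an analytic extension to $\mathbb{D}$ and $[C_\mu^-]^n_0$ is the subspace of functions having an analytic extension to $\mathbb{C}\setminus\overline{\mathbb{D}}$ that vanishes at infinity; $[C_\mu^-]^n=[C_\mu^-]^n_0\oplus\mathbb{C}^n$. $P^+\colon[C_\mu(S^1)]^n\to[C_\mu^+]^n$ is the associated projection (with kernel $[C_\mu^-]^n_0$), and $GI_+$ denotes multiplication by $G$ on $[C_\mu^+]^n$. *)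

(* Defs.v *)
From HB Require Import structures.
From mathcomp Require Import all_boot all_order all_algebra.
From mathcomp Require Import all_classical all_reals all_analysis.
From mathcomp Require Import complex.

Set Implicit Arguments.
Unset Strict Implicit.
Unset Printing Implicit Defensive.

Import Order.TTheory GRing.Theory Num.Theory.
Import numFieldNormedType.Exports.

Local Open Scope classical_set_scope.
Local Open Scope ring_scope.

(* The library gives a topology and a norm to any numFieldType, but none to the
   bare type R[i]. *)
Definition Cplx (R : realType) : numFieldType := R[i].

Definition circle (R : realType) := {z : Cplx R | `|z| == 1}.

Section HolderSpaces.
Context {R : realType}.
Implicit Types (mu : R) (f : circle R -> Cplx R) (F : Cplx R -> Cplx R).

Definition holder mu : set (circle R -> Cplx R) :=
  [set f | exists M : R, forall z w : circle R,
    Normc.normc (f z - f w) <= M * Normc.normc (val z - val w) `^ mu].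

(* Analytic means complex differentiable at each point of the open set. An
   extension of f is moreover continuous up to the circle, where it equals f. *)
Definition disc_extension f F : Prop :=
  [/\ forall z : Cplx R, `|z| < 1 -> derivable F z 1,
      {within [set z : Cplx R | `|z| <= 1], continuous F}
    & forall z : circle R, F (val z) = f z].

Definition exterior_extension f F : Prop :=
  [/\ forall z : Cplx R, 1 < `|z| -> derivable F z 1,
      {within [set z : Cplx R | 1 <= `|z|], continuous F}
    & forall z : circle R, F (val z) = f z].

(* The limit of F at infinity, in the coordinate w = 1 / z. *)
Definition value_at_infty f (c : Cplx R) : Prop :=
  exists2 F, exterior_extension f F & F w^-1 @[w --> (0 : Cplx R)^'] --> c.

Definition holder_plus mu : set (circle R -> Cplx R) :=
  [set f | holder mu f /\ exists F, disc_extension f F].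

Definition holder_minus0 mu : set (circle R -> Cplx R) :=
  [set f | holder mu f /\ value_at_infty f 0].

Definition vec n (A : set (circle R -> Cplx R)) :
    set (circle R -> 'cV[Cplx R]_n) :=
  [set Phi | forall i, A (fun z => Phi z i ord0)].

Definition holder_minus_vec mu n : set (circle R -> 'cV[Cplx R]_n) :=
  [set Phi | exists2 Psi, vec (holder_minus0 mu) Psi
           & exists c : 'cV[Cplx R]_n, Phi = Psi + cst c].

Definition vec_value_at_infty n (Phi : circle R -> 'cV[Cplx R]_n)
    (c : 'cV[Cplx R]_n) : Prop :=
  forall i, value_at_infty (fun z => Phi z i ord0) (c i ord0).

End HolderSpaces.

Definition direct_sum (E : zmodType) (V U W : set E) : Prop :=
  V = [set f | exists u w, [/\ U u, W w & f = u + w]] /\ U `&` W = [set 0].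

(* p is the projection of V onto U along W, where V is the direct sum of U and
   W; its values outside V are irrelevant. *)
Definition projection_along (E : zmodType) (V U W : set E) (p : E -> E) :=
  direct_sum V U W /\ forall u w, U u -> W w -> p (u + w) = u.

Definition is_Pplus (R : realType) (mu : R) n :
    ((circle R -> 'cV[Cplx R]_n) -> (circle R -> 'cV[Cplx R]_n)) -> Prop :=
  projection_along (vec (holder mu)) (vec (holder_plus mu))
    (vec (holder_minus0 mu)).

Definition expm (R : realType) n (A : 'M[Cplx R]_n) : 'M[Cplx R]_n :=
  limn (series (fun k => (k`!%:R)^-1 *: A ^+ k)).

(* Only the coefficients L k with - m <= k <= 1 are used. *)
Definition laurent (R : realType) n (m : nat) (L : int -> 'M[Cplx R]_n)
    (z : circle R) : 'M[Cplx R]_n :=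
  \sum_(j < m.+2) (val z ^ (j%:Z - m%:Z)) *: L (j%:Z - m%:Z).

Definition mulG (R : realType) n (G : circle R -> 'M[Cplx R]_n)
    (Phi : circle R -> 'cV[Cplx R]_n) : circle R -> 'cV[Cplx R]_n :=
  fun z => G z *m Phi z.

Definition toeplitz (R : realType) n
    (Pplus : (circle R -> 'cV[Cplx R]_n) -> (circle R -> 'cV[Cplx R]_n))
    (G : circle R -> 'M[Cplx R]_n) (Phi : circle R -> 'cV[Cplx R]_n) :=
  Pplus (mulG G Phi).

Definition toeplitz_ker (R : realType) (mu : R) n
    (Pplus : (circle R -> 'cV[Cplx R]_n) -> (circle R -> 'cV[Cplx R]_n))
    (G : circle R -> 'M[Cplx R]_n) : set (circle R -> 'cV[Cplx R]_n) :=
  [set Phi | vec (holder_plus mu) Phi /\ toeplitz Pplus G Phi = 0].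

Definition riemann_hilbert (R : realType) (mu : R) n
    (G : circle R -> 'M[Cplx R]_n)
    (Phip Phim : circle R -> 'cV[Cplx R]_n) : Prop :=
  [/\ vec (holder_plus mu) Phip, holder_minus_vec mu Phim,
      forall z : circle R, G z *m Phip z = Phim z
    & vec_value_at_infty Phim 0].

(* Main.v *)
(* If G Phi is Hölder continuous, P^+ (G Phi) = 0 says exactly that G Phi lies in
   [C_mu^-]^n_0, so the solutions of the Riemann-Hilbert problem are the pairs
   (Phi, G Phi) with Phi in ker T_G; in particular Phi^+ = 0 forces Phi^- = 0.
   What has to be proved is that exp (t L_0) is Hölder continuous. If the
   entries of A are bounded by K and have Hölder constant K, then those of A^k
   are bounded by Q^k and have Hölder constant Q^k with Q = 2 n K, so those of
   exp A have Hölder constant e^Q. *)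
Require Import Defs.
From mathcomp Require Import all_boot all_order all_algebra.
From mathcomp Require Import all_classical all_reals all_analysis.
From mathcomp Require Import complex ring.

Set Implicit Arguments.
Unset Strict Implicit.
Unset Printing Implicit Defensive.

Import Order.TTheory GRing.Theory Num.Theory numFieldNormedType.Exports.
Local Open Scope classical_set_scope.
Local Open Scope ring_scope.

Local Notation normc := Normc.normc.

(** * The real-valued modulus on complex numbers *)

Lemma norm_CplxE (R : realType) (z : Cplx R) : `|z| = (normc z)%:C%C.
Proof. by []. Qed.

Lemma normc_nonneg (R : realType) (z : Cplx R) : 0 <= normc z.
Proof. by rewrite -lecR -norm_CplxE normr_ge0. Qed.

Lemma normc_distC (R : realType) (z w : Cplx R) : normc (z - w) = normc (w - z).
Proof. by rewrite -[in LHS]opprB normcN. Qed.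

Lemma normc_mul (R : realType) (z w : Cplx R) :
  normc (z * w) = normc z * normc w.
Proof. exact: Normc.normcM. Qed.

Lemma normc_circle (R : realType) (z : circle R) : normc (val z) = 1.
Proof. by have := valP z; rewrite norm_CplxE => /eqP[]. Qed.

Lemma normc_sum (R : realType) (I : Type) (r : seq I) (F : I -> Cplx R) :
  normc (\sum_(i <- r) F i) <= \sum_(i <- r) normc (F i).
Proof.
elim/big_rec2: _ => [|i y x _ le_xy]; first by rewrite Normc.normc0.
by apply: le_trans (le_normcD _ _) _; rewrite lerD2l.
Qed.

(** * Convergence of complex series and of matrix sequences *)

Lemma Re_le_normc (R : realType) (z : Cplx R) : `|complex.Re z| <= normc z.
Proof. by case: z => a b /=; rewrite -sqrtr_sqr ler_wsqrtr// lerDl sqr_ge0. Qed.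

Lemma Im_le_normc (R : realType) (z : Cplx R) : `|complex.Im z| <= normc z.
Proof. by case: z => a b /=; rewrite -sqrtr_sqr ler_wsqrtr// lerDr sqr_ge0. Qed.

Lemma normc_le_ReDIm (R : realType) (z : Cplx R) :
  normc z <= `|complex.Re z| + `|complex.Im z|.
Proof.
case: z => a b /=; rewrite -[leRHS]ger0_norm ?addr_ge0// -[leRHS]sqrtr_sqr.
by rewrite ler_wsqrtr// sqrrD !real_normK ?num_real// addrAC lerDl mulrn_wge0.
Qed.

(** Real and imaginary parts are dominated by [v], so both are absolutely convergent real series;
    their sums assemble into the complex limit. *)
Lemma is_cvg_series_Cplx (R : realType) (u : nat -> Cplx R) (v : nat -> R) :
  (forall k, normc (u k) <= v k) -> cvgn (series v) -> cvgn (series u).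
Proof.
move=> uv cv.
have v0 k : 0 <= v k by exact: le_trans (normc_nonneg _) (uv k).
have dom (w : nat -> R) : (forall k, `|w k| <= normc (u k)) -> cvgn (series w).
  move=> wu; apply: normed_cvg; apply: (series_le_cvg _ v0 _ cv) => //= k.
  exact: le_trans (wu k) (uv k).
have cRe := dom (fun k => complex.Re (u k)) (fun k => Re_le_normc _).
have cIm := dom (fun k => complex.Im (u k)) (fun k => Im_le_normc _).
apply/cvg_ex; exists (limn (series (fun k => complex.Re (u k))) +i*
  limn (series (fun k => complex.Im (u k))) : Cplx R)%C.
apply/cvgrPdist_lt => -[e e'] /=.
(* The radius is a priori a complex number; positivity forces its imaginary part to vanish. *)
rewrite ltcE /= => /andP[/eqP -> e0].
have e20 : 0 < e / 2 by rewrite divr_gt0.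
move/cvgrPdist_lt: cRe => /(_ _ e20) cRe.
move/cvgrPdist_lt: cIm => /(_ _ e20) cIm.
near=> N.
rewrite norm_CplxE ltcR; apply: le_lt_trans (normc_le_ReDIm _) _.
rewrite [e]splitr; apply: ltrD.
  by rewrite raddfB raddf_sum; near: N.
by rewrite raddfB raddf_sum; near: N.
Unshelve. all: by end_near. Qed.

(** A neighbourhood of [M] contains a product of neighbourhoods of its finitely many entries, and a
    filter is closed under finite intersections. *)
Lemma cvg_mx (R : realType) (m n : nat) (u : nat -> 'M[Cplx R]_(m, n))
    (M : 'M[Cplx R]_(m, n)) :
  (forall i j, u k i j @[k --> \oo] --> M i j) -> u @ \oo --> M.
Proof.
move=> uM A [P MP sPA]; apply: filterS (_ : \forall k \near \oo,
  forall i j, P i j (u k i j)); first by move=> k; exact: sPA.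
by apply: filter_forall => i; apply: filter_forall => j; exact: uM (MP i j).
Qed.

Lemma is_cvg_mx (R : realType) (m n : nat) (u : nat -> 'M[Cplx R]_(m, n)) :
  (forall i j, cvgn (fun k => u k i j)) -> cvgn u.
Proof.
move=> cu; apply/cvg_ex.
exists (\matrix_(i, j) limn (fun k => u k i j)).
by apply: cvg_mx => i j; rewrite mxE; exact: cu.
Qed.

Lemma cvg_mx_entry (R : realType) (m n : nat) (u : nat -> 'M[Cplx R]_(m, n)) i j :
  cvgn u -> u k i j @[k --> \oo] --> limn u i j.
Proof. move=> cu; exact: (continuous_cvg _ (@coord_continuous _ m n i j _) cu). Qed.

(** Serves to carry a Hölder estimate from the partial sums of the exponential series to its
    limit. *)
Lemma normc_lim_le (R : realType) (u : nat -> Cplx R) (l : Cplx R) (C : R) :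
  u @ \oo --> l -> (forall k, normc (u k) <= C) -> normc l <= C.
Proof.
move=> ul uC; apply/ler_addgt0Pr => e e0.
have e0' : 0 < (e%:C)%C :> Cplx R by rewrite ltcR.
move/cvgrPdist_lt: ul => /(_ _ e0') /filter_ex[k].
rewrite norm_CplxE ltcR => lt_e.
rewrite -(subrK (u k) l) addrC; apply: le_trans (le_normcD _ _) _.
by rewrite lerD// ltW.
Qed.

(** * Algebra of Hölder functions on the circle *)

Section Holder.
Context {R : realType} {mu : R}.
Hypothesis mu01 : 0 < mu < 1.
Implicit Types f g : circle R -> Cplx R.

Local Notation dist := (fun z w : circle R => normc (val z - val w) `^ mu).

Let mu_ge0 : 0 <= mu. Proof. by case/andP: mu01 => /ltW. Qed.

Lemma circle_dist_le2 (z w : circle R) : normc (val z - val w) <= 2.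
Proof.
by apply: le_trans (le_normcD _ _) _; rewrite normcN !normc_circle.
Qed.

Lemma holder_ge0 f : holder mu f -> exists2 M, 0 <= M &
  forall z w, normc (f z - f w) <= M * dist z w.
Proof.
move=> [M fM]; exists `|M| => // z w; apply: le_trans (fM z w) _.
by rewrite ler_wpM2r ?powR_ge0 ?ler_norm.
Qed.

(** Any two points of the circle are at distance at most 2, so [f z] stays within M 2^mu of the
    value of [f] at the base point 1. *)
Lemma holder_bounded f : holder mu f ->
  exists2 B, 0 <= B & forall z, normc (f z) <= B.
Proof.
move=> /holder_ge0[M M0 fM].
have one_circle : `|1 : Cplx R| == 1 by rewrite normr1.
pose e : circle R := exist _ 1 one_circle.
exists (M * 2 `^ mu + normc (f e)).
  by rewrite addr_ge0 ?mulr_ge0 ?powR_ge0 ?normc_nonneg.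
move=> z; rewrite -[f z](subrK (f e)); apply: le_trans (le_normcD _ _) _.
rewrite lerD2r; apply: le_trans (fM _ _) _; rewrite ler_wpM2l//.
by apply: ge0_ler_powR; rewrite ?nnegrE ?normc_nonneg// circle_dist_le2.
Qed.

Lemma holder_cst (c : Cplx R) : holder mu (fun=> c).
Proof. by exists 0 => z w; rewrite subrr Normc.normc0 mul0r. Qed.

Lemma holderD f g : holder mu f -> holder mu g ->
  holder mu (fun z => f z + g z).
Proof.
move=> [M fM] [N gN]; exists (M + N) => z w.
rewrite opprD addrACA mulrDl; apply: le_trans (le_normcD _ _) _.
exact: lerD.
Qed.

Lemma holderM f g : holder mu f -> holder mu g ->
  holder mu (fun z => f z * g z).
Proof.
move=> fH gH; have [B B0 fB] := holder_bounded fH.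
have [C C0 gC] := holder_bounded gH.
have [M M0 fM] := holder_ge0 fH; have [N N0 gN] := holder_ge0 gH.
exists (B * N + C * M) => z w.
have -> : f z * g z - f w * g w = f z * (g z - g w) + g w * (f z - f w).
  by ring.
apply: le_trans (le_normcD _ _) _; rewrite !normc_mul mulrDl -!mulrA.
by rewrite lerD// ler_pM ?normc_nonneg.
Qed.

Lemma holder_sum (I : Type) (r : seq I) (F : I -> circle R -> Cplx R) :
  (forall i, holder mu (F i)) -> holder mu (fun z => \sum_(i <- r) F i z).
Proof.
move=> FH; elim: r => [|i r IHr].
  by under eq_fun do rewrite big_nil; exact: holder_cst.
by under eq_fun do rewrite big_cons; exact: holderD.
Qed.

(** A distance x on the circle is at most 2, hence x = x^(1 - mu) x^mu is at most 2^(1 - mu)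
    x^mu. *)
Lemma holder_contraction f :
  (forall z w, normc (f z - f w) <= normc (val z - val w)) -> holder mu f.
Proof.
move=> fle; exists (2 `^ (1 - mu)) => z w; apply: le_trans (fle z w) _.
set x := normc _; have [->|x_neq0] := eqVneq x 0.
  by rewrite mulr_ge0 ?powR_ge0.
have x_ge0 : 0 <= x by exact: normc_nonneg.
rewrite -[leLHS](powRr1 x_ge0) -{1}(subrK mu 1) powRD ?x_neq0 ?implybT//.
rewrite ler_wpM2r ?powR_ge0// ge0_ler_powR ?nnegrE ?circle_dist_le2//.
by rewrite subr_ge0; case/andP: mu01 => _ /ltW.
Qed.

Lemma holder_val : holder mu val.
Proof. exact: holder_contraction. Qed.

Lemma circle_neq0 (z : circle R) : val z != 0.
Proof.
by apply/eqP => z0; have := normc_circle z; rewrite z0 Normc.normc0;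
  apply/eqP; rewrite eq_sym oner_eq0.
Qed.

(** Inversion is an isometry of the circle: 1/z - 1/w = (w - z)/(zw) and |zw| = 1. *)
Lemma holder_inv : holder mu (fun z => (val z)^-1).
Proof.
apply: holder_contraction => z w.
have -> : (val z)^-1 - (val w)^-1 = (val z)^-1 * (val w)^-1 * (val w - val z).
  by field; rewrite !circle_neq0.
by rewrite !normc_mul !Normc.normcV !normc_circle invr1 !mul1r normc_distC.
Qed.

Lemma holderX f k : holder mu f -> holder mu (fun z => f z ^+ k).
Proof.
move=> fH; elim: k => [|k IHk]; first exact: holder_cst.
by under eq_fun do rewrite exprS; exact: holderM.
Qed.

Lemma holder_exprz (k : int) : holder mu (fun z => val z ^ k).
Proof.
case: k => k; first exact: holderX holder_val.
under eq_fun do rewrite NegzE -exprz_inv; exact: holderX holder_inv.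
Qed.

Lemma holder_laurent n m (L : int -> 'M[Cplx R]_n) i j :
  holder mu (fun z => laurent m L z i j).
Proof.
under eq_fun do rewrite /laurent summxE.
apply: holder_sum => k; under eq_fun do rewrite mxE.
by apply: holderM (holder_cst _); exact: holder_exprz.
Qed.

(** * Powers and exponential of a Hölder matrix function *)

Lemma holder_mx_uniform n (A : circle R -> 'M[Cplx R]_n) :
  (forall i j, holder mu (fun z => A z i j)) -> exists2 K, 0 <= K &
  forall i j, (forall z, normc (A z i j) <= K) /\
    forall z w, normc (A z i j - A w i j) <= K * dist z w.
Proof.
move=> AH.
have ex (p : 'I_n * 'I_n) : exists K, [/\ 0 <= K,
    forall z, normc (A z p.1 p.2) <= K &
    forall z w, normc (A z p.1 p.2 - A w p.1 p.2) <= K * dist z w].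
  have [B B0 AB] := holder_bounded (AH p.1 p.2).
  have [M M0 AM] := holder_ge0 (AH p.1 p.2).
  exists (B + M); split => [|z|z w]; first exact: addr_ge0.
    by rewrite (le_trans (AB z))// lerDl.
  by rewrite (le_trans (AM z w))// ler_wpM2r ?powR_ge0// lerDr.
(* All [K p] are nonnegative, so their sum over the index pairs dominates each of them. *)
have [K KP] := choice ex; exists (\sum_p K p).
  by apply: sumr_ge0 => p _; have [] := KP p.
move=> i j; have [_ KA KD] := KP (i, j).
have leK : K (i, j) <= \sum_p K p.
  by rewrite (bigD1 (i, j))//= lerDl; apply: sumr_ge0 => p _; have [] := KP p.
split=> [z|z w]; first exact: le_trans (KA z) leK.
by rewrite (le_trans (KD z w))// ler_wpM2r ?powR_ge0.
Qed.

(** An entry of the next power is a sum of [n] products, and the difference of two products splits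
    as x(p - q) + (x - y)q, two terms of size at most K Q^k times the distance factor; hence Q =
    n(2K). Both bounds go through one induction because the difference bound uses the size bound of
    the previous power. *)
Lemma mx_powers_bound n (A : circle R -> 'M[Cplx R]_n) K :
  0 <= K ->
  (forall i j, (forall z, normc (A z i j) <= K) /\
    forall z w, normc (A z i j - A w i j) <= K * dist z w) ->
  forall k i j, (forall z, normc ((A z ^+ k) i j) <= (n%:R * (2 * K)) ^+ k) /\
    forall z w, normc ((A z ^+ k) i j - (A w ^+ k) i j) <=
      (n%:R * (2 * K)) ^+ k * dist z w.
Proof.
move=> K0 AK; set Q := n%:R * (2 * K).
have Q0 : 0 <= Q by rewrite !mulr_ge0.
have sum_cst (c : R) : \sum_(l < n) c = n%:R * c.
  by rewrite sumr_const card_ord mulr_natl.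
elim=> [|k IHk] i j.
  split=> [z|z w]; last by rewrite subrr Normc.normc0 mulr_ge0 ?powR_ge0.
  by rewrite expr0 mxE; case: (i == j); rewrite ?Normc.normc1 ?Normc.normc0.
split=> [z|z w].
  rewrite exprS mxE; apply: le_trans (normc_sum _ _) _.
  apply: le_trans (_ : n%:R * (K * Q ^+ k) <= _).
    rewrite -sum_cst; apply: ler_sum => l _; rewrite normc_mul.
    by rewrite ler_pM ?normc_nonneg//; [exact: (AK i l).1|exact: (IHk l j).1].
  (* The sizes grow only by the factor nK; the extra 2 is slack that lets one Q serve both
     bounds. *)
  rewrite exprS /Q -!mulrA ler_wpM2l//.
  by rewrite -[leLHS]mul1r ler_wpM2r ?mulr_ge0 ?exprn_ge0 ?ler1n.
rewrite !exprS !mxE -sumrB; apply: le_trans (normc_sum _ _) _.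
have -> : Q * Q ^+ k * dist z w = n%:R * (2 * (K * Q ^+ k * dist z w)).
  by rewrite /Q; ring.
rewrite -sum_cst; apply: ler_sum => l _.
set x := A z i l; set y := A w i l; set p := (A z ^+ k) l j.
set q := (A w ^+ k) l j.
have -> : x * p - y * q = x * (p - q) + (x - y) * q by ring.
apply: le_trans (le_normcD _ _) _; rewrite !normc_mul mulr2n mulrDl mul1r.
apply: lerD.
  by rewrite -mulrA ler_pM ?normc_nonneg//; [exact: (AK i l).1|exact: (IHk l j).2].
rewrite mulrAC ler_pM ?normc_nonneg//; [exact: (AK i l).2|exact: (IHk l j).1].
Qed.

Lemma holder_expm n (A : circle R -> 'M[Cplx R]_n) :
  (forall i j, holder mu (fun z => A z i j)) ->
  forall i j, holder mu (fun z => expm (A z) i j).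
Proof.
move=> /holder_mx_uniform[K K0 AK] i j.
have := mx_powers_bound K0 AK; set Q := n%:R * (2 * K) => AQ.
have Q0 : 0 <= Q by rewrite !mulr_ge0.
pose u z k := (k`!%:R : Cplx R)^-1 *: A z ^+ k.
have cE := is_cvg_series_exp_coeff Q.
(* The factorial on the left is a complex number, the one on the right a real number. *)
have fact_norm k (x : Cplx R) :
    normc ((k`!%:R)^-1 * x) = (k`!%:R)^-1 * normc x.
  rewrite normc_mul Normc.normcV; congr (_^-1 * _).
  by rewrite -[k`!%:R]/(1 *+ _) normcMn Normc.normc1.
have seriesE z i' j' : (fun k => series (u z) k i' j') =
    series (fun k => u z k i' j').
  by apply/funext => k; rewrite /series /= summxE.
(* [expm] is a bare [limn], which means the sum of the series only once convergence is known; the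
   exponential series of Q dominates every entry. *)
have cu z : cvgn (series (u z)).
  apply: is_cvg_mx => i' j'; rewrite seriesE; apply: is_cvg_series_Cplx cE => k.
  rewrite /u mxE fact_norm /exp_coeff /= mulrC ler_wpM2r ?invr_ge0//.
  exact: (AQ k i' j').1.
exists (expR Q) => z w.
have cij z' : series (fun k => u z' k i j) @ \oo --> expm (A z') i j.
  by rewrite -seriesE; exact: cvg_mx_entry (cu z').
apply: normc_lim_le (cvgB (cij z) (cij w)) _ => N /=.
rewrite fctE /series /= -sumrB; apply: le_trans (normc_sum _ _) _.
(* The Hölder constants of the partial sums are partial sums of e^Q; these increase to [expR Q],
   which bounds them for every [N]. *)
apply: le_trans (_ : series (exp_coeff Q) N * dist z w <= _); last first.
  rewrite ler_wpM2r ?powR_ge0//; apply: nondecreasing_cvgn_le cE _.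
  by apply: nondecreasing_series => k _ _; exact: exp_coeff_ge0.
rewrite /series /= mulr_suml; apply: ler_sum => k _.
rewrite /u !mxE -mulrBr fact_norm /exp_coeff /= mulrAC mulrC ler_wpM2r ?invr_ge0//.
exact: (AQ k i j).2.
Qed.

Lemma vec_holder_mulG n (G : circle R -> 'M[Cplx R]_n)
    (Phi : circle R -> 'cV[Cplx R]_n) :
  (forall i j, holder mu (fun z => G z i j)) -> vec (holder mu) Phi ->
  vec (holder mu) (mulG G Phi).
Proof.
move=> GH PhiH i; rewrite /mulG; under eq_fun do rewrite mxE.
by apply: holder_sum => k; exact: holderM.
Qed.

End Holder.

(** * The Toeplitz kernel and the Riemann-Hilbert problem *)

Lemma disc_extension0 (R : realType) : disc_extension (0 : circle R -> Cplx R) 0.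
Proof.
split=> [z _||//]; first exact: derivable_cst.
exact/continuous_subspaceT/cst_continuous.
Qed.

Theorem proposition3p2 (R : realType) (mu : R) (hmu : 0 < mu < 1)
  (n m : nat) (L0 : int -> 'M[Cplx R]_n) (t : Cplx R)
  (Pplus : (circle R -> 'cV[Cplx R]_n) -> (circle R -> 'cV[Cplx R]_n))
  (hP : is_Pplus mu Pplus)
  (G : circle R -> 'M[Cplx R]_n)
  (hG : G = fun z => expm (t *: laurent m L0 z)) :
  (exists2 Phi, toeplitz_ker mu Pplus G Phi & Phi <> 0) <->
  (exists Phip Phim, riemann_hilbert mu G Phip Phim /\
     (Phip, Phim) <> (0, 0)).
Proof.
have [[decomp _] proj] := hP.
split=> [[Phi [PhiP kerPhi] Phi0]|[Phip [Phim [[PhipP PhimM GPhi Phim0] nz]]]].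
  (* Hölder continuity of [G] places [mulG G Phi] in the space that [decomp] splits. *)
  have GH i j : holder mu (fun z => G z i j).
    rewrite hG; apply: (holder_expm hmu) => i' j'; under eq_fun do rewrite mxE.
    exact: (holderM hmu (holder_cst t) (holder_laurent hmu m L0 i' j')).
  have : vec (holder mu) (mulG G Phi).
    by apply: (vec_holder_mulG hmu) => // i; have [] := PhiP i.
  rewrite decomp => -[u [w [uP wM GPhiE]]].
  (* [Pplus] sends [u + w] to [u], and [kerPhi] makes this value 0; only the component [w] in the
     minus space remains. *)
  have u0 : u = 0 by rewrite -(proj u w uP wM) -GPhiE.
  have {}wM : vec (holder_minus0 mu) (mulG G Phi) by rewrite GPhiE u0 add0r.
  exists Phi, (mulG G Phi); split; last by move=> [].
  split => //.
    by exists (mulG G Phi) => //; exists 0; apply/funext => z; rewrite fctE addr0.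
  by move=> i; rewrite mxE; have [] := wM i.
have PhimE : mulG G Phip = Phim by apply/funext.
have Phim0M : vec (holder_minus0 mu) Phim.
  (* The Hölder half comes from [Psi] plus the constant [c]; the extension vanishing at infinity is
     supplied by [Phim0] itself. *)
  move=> i; split; last by have := Phim0 i; rewrite mxE.
  have [Psi PsiM [c ->]] := PhimM.
  under eq_fun do rewrite fctE mxE.
  by apply: holderD (holder_cst _); have [] := PsiM i.
(* With 0 in the plus space, [0 + Phim] is a decomposition of [Phim], and [proj] gives the value 0
   of [Pplus] there. *)
have zeroP : vec (holder_plus mu) (0 : circle R -> 'cV[Cplx R]_n).
  move=> i; rewrite (_ : (fun _ => _) = 0); last first.
    by apply/funext => z; rewrite mxE.
  by split; [exact: holder_cst | exists 0; exact: disc_extension0].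
exists Phip; first split=> //.
  by rewrite /toeplitz PhimE -[Phim]add0r; exact: proj.
move=> Phip0; apply: nz; rewrite -PhimE Phip0; congr (_, _).
by apply/funext => z; rewrite /mulG mulmx0.
Qed.
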